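(* Let $\ell\ge 2$ be an integer, $R=\mathrm{GR}(4,2)$, and let $\mathcal L_\beta\subset R\times\mathbb F_4^{2\ell-2}$, $\beta\in\mathbb F_4=\{0,1,\alpha,\alpha^2\}$, be the sets defined in the context. Then $\mathcal L_0\setminus\{0\}$, $\mathcal L_1$, $\mathcal L_\alpha$ and $\mathcal L_{\alpha^2}$ are negative Latin square type partial difference sets in the additive group of $R\times\mathbb F_4^{2\ell-2}$, and the strongly regular Cayley graphs associated to these four sets form a 4-class amorphic association scheme on $R\times\mathbb F_4^{2\ell-2}$.
   Context: Galois ring. $R=\mathrm{GR}(4,2)=\mathbb Z_4[x]/\langle x^2+x+1\rangle=\mathbb Z_4[\xi]$, where $\xi$ is a root of $x^2+x+1$. It is a local ring with maximal ideal $2R$ and $R/2R\cong\mathbb F_4$; $\pi:R\to\mathbb F_4$ is the reduction map, and $\alpha=\pi(\xi)$, so $\mathbb F_4=\{0,1,\alpha,\alpha^2=\alpha+1\}$. The Teichmüller set is $\mathcal T=\{0,1,\xi,\xi^2\}$; $\pi$ restricts to a bijection $\mathcal T\to\mathbb F_4$, whose inverse is denoted $\pi^{-1}$. Every element of $R$ is uniquely $\xi_1+2\xi_2$ with $\xi_1,\xi_2\in\mathcal T$. Sets. Let $Q(x_1,\dots,x_{2\ell})=\alpha x_1^2+x_1x_2+x_2^2+x_3x_4+\cdots+x_{2\ell-1}x_{2\ell}$ on $\mathbb F_4^{2\ell}$, and $D_\beta=\{v\in\mathbb F_4^{2\ell}: Q(v)=\beta\}$ for $\beta\in\mathbb F_4$.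 Let $F:\mathbb F_4^{2\ell}\to R\times\mathbb F_4^{2\ell-2}$ be the bijection $F(x_1,\dots,x_{2\ell})=(\pi^{-1}(x_1)+2\pi^{-1}(x_2),x_3,\dots,x_{2\ell})$, and put $\mathcal L_\beta=F(D_\beta)$. Partial difference sets. A $k$-subset $D$ of a finite group $G$ of order $v$ (written additively) is a $(v,k,\lambda,\mu)$-partial difference set (PDS) if the list of differences $d_1-d_2$, $d_1,d_2\in D$, $d_1\ne d_2$, contains each nonidentity element of $D$ exactly $\lambda$ times and each nonidentity element of $G\setminus D$ exactly $\mu$ times. It is of negative Latin square type if $(v,k,\lambda,\mu)=(n^2,r(n+1),-n+r^2+3r,r^2+r)$ for some $n,r$. The Cayley graph associated to $D$ has vertex set $G$, with $x,y$ adjacent iff $x-y\in D$. Association schemes. A (symmetric) association scheme with $d$ classes on a finite set $X$ is a partition of $X\times X$ into relations $R_0,\dots,R_d$ with $R_0$ the diagonal, each $R_i$ ($i\ge1$) symmetric, and such that for all $i,j,k\in\{0,\dots,d\}$ there is an integer $p_{ij}^k$ with $|\{z\in X:(x,z)\in R_i,(z,y)\in R_j\}|=p_{ij}^k$ for all $(x,y)\in R_k$. Graphs $G_1,\dots,G_d$ on $X$ form an association scheme if the diagonal together with their (symmetric) adjacency relations is one. A fusion is obtained by taking unions of the classes $R_1,\dots,R_d$ according to a partition of $\{1,\dots,d\}$; the scheme is amorphic if every fusion is also an association scheme. *)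

(* Defs.v *)
From HB Require Import structures.
From mathcomp Require Import all_boot all_order all_algebra all_field.

Set Implicit Arguments.
Unset Strict Implicit.
Unset Printing Implicit Defensive.

Import GRing.Theory.
Local Open Scope ring_scope.

Definition is_pds (G : finZmodType) (v k lambda mu : nat) (D : {set G}) : Prop :=
  [/\ #|G| = v, #|D| = k &
      forall g : G, g != 0 ->
        #|[set d in setX D D | (d.1 != d.2) && (d.1 - d.2 == g)]|
        = if g \in D then lambda else mu].

(* The equation for lambda is stated in int, as - n + r^2 + 3r involves a
   subtraction. *)
Definition negative_latin_square_params (v k lambda mu : nat) : Prop :=
  exists n r : nat,
    [/\ v = (n ^ 2)%N, k = (r * (n + 1))%N,
        lambda%:Z = - n%:Z + r%:Z ^+ 2 + 3 * r%:Z & mu = (r ^ 2 + r)%N].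

Definition negative_latin_square_pds (G : finZmodType) (D : {set G}) : Prop :=
  exists v k lambda mu : nat,
    is_pds v k lambda mu D /\ negative_latin_square_params v k lambda mu.

Definition cayley (G : finZmodType) (D : {set G}) : rel G :=
  fun x y => x - y \in D.

(* The bounds on k exclude the edgeless and the complete graph. *)
Definition strongly_regular (X : finType) (e : rel X) : Prop :=
  [/\ symmetric e, irreflexive e &
      exists k lambda mu : nat,
        [/\ (0 < k < #|X|.-1)%N,
            forall x, #|[set y | e x y]| = k &
            forall x y, x != y ->
              #|[set z | e x z && e y z]| = if e x y then lambda else mu]].

(* Injectivity of R together with [partition] (whose blocks are nonempty and
   pairwise disjoint) says that R_0, ..., R_d are d + 1 nonempty, pairwise
   disjoint relations covering X * X. *)
Definition assoc_scheme (X : finType) (d : nat) (R : 'I_d.+1 -> {set X * X}) :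
    Prop :=
  [/\ injective R,
      partition [set R i | i : 'I_d.+1] [set: X * X],
      R ord0 = [set p | p.1 == p.2],
      forall i x y, i != ord0 -> ((x, y) \in R i) = ((y, x) \in R i) &
      forall i j k, exists p : nat, forall x y, (x, y) \in R k ->
        #|[set z | ((x, z) \in R i) && ((z, y) \in R j)]| = p].

Definition with_diagonal (X : finType) (d : nat) (C : 'I_d -> {set X * X}) :
    'I_d.+1 -> {set X * X} :=
  fun i => if unlift ord0 i is Some j then C j else [set p | p.1 == p.2].

(* The classes R_1, ..., R_d are the R (lift ord0 i) for i : 'I_d; the fused
   classes are indexed by the blocks of the partition P of 'I_d. *)
Definition fusion (X : finType) (d : nat) (R : 'I_d.+1 -> {set X * X})
    (P : {set {set 'I_d}}) : 'I_#|P|.+1 -> {set X * X} :=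
  with_diagonal
    (fun b : 'I_#|P| => \bigcup_(i in enum_val b) R (lift ord0 i)).

Arguments fusion {X d} R P.

Definition amorphic_scheme (X : finType) (d : nat)
    (R : 'I_d.+1 -> {set X * X}) : Prop :=
  assoc_scheme R /\
  forall P : {set {set 'I_d}}, partition P [set: 'I_d] ->
    assoc_scheme (fusion R P).

Definition graph_relations (X : finType) (d : nat) (e : 'I_d -> rel X) :
    'I_d.+1 -> {set X * X} :=
  with_diagonal (fun j => [set p | e j p.1 p.2]).

Definition GR42 : predArgType := {poly %/ ('X^2 + 'X + 1 : {poly 'Z_4})}.

HB.instance Definition _ := GRing.ComNzRing.on GR42.
HB.instance Definition _ := Finite.on GR42.

Definition xi : GR42 := 'qX.

Definition F4_poly : {poly 'F_2} := 'X^2 + 'X + 1.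

Lemma F4_polyE : F4_poly = Poly [:: 1; 1; 1].
Proof.
apply/polyP => i; rewrite /F4_poly !coefD coefXn coefX coef1 coef_Poly.
by case: i => [|[|[|i]]] //=; rewrite ?nth_nil ?add0r ?addr0.
Qed.

Lemma size_F4_poly : size F4_poly = 3.
Proof. by rewrite F4_polyE (@PolyK _ 0) // oner_neq0. Qed.

Lemma F4_poly_mi : monic_irreducible_poly F4_poly.
Proof.
split; last first.
  by apply/eqP; rewrite /lead_coef size_F4_poly F4_polyE coef_Poly.
apply: cubic_irreducible; first by rewrite size_F4_poly.
move=> x; rewrite /root /F4_poly !hornerE.
by case: x => [[|[|m]] lem].
Qed.

Definition F4 : predArgType := {poly %/ F4_poly with F4_poly_mi}.

HB.instance Definition _ := GRing.Field.on F4.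
HB.instance Definition _ := Finite.on F4.

Definition red (r : GR42) : F4 :=
  in_qpoly F4_poly
    (map_poly (fun c : 'Z_4 => (c : nat)%:R : 'F_2) (r : {poly 'Z_4})).

Definition alpha : F4 := red xi.

Definition teichmuller : {set GR42} := [set 0; 1; xi; xi ^+ 2].

(* The inverse of the bijection red : teichmuller -> F4; the default value 0
   is never used. *)
Definition red_inv (a : F4) : GR42 :=
  odflt 0 [pick t in teichmuller | red t == a].

(* The coordinate x_k of x, numbered from 1 as in x = (x_1, ..., x_n); only
   used for 1 <= k <= n. *)
Definition coord1 (n : nat) (x : 'rV[F4]_n) (k : nat) : F4 :=
  if insub k.-1 is Some i then x 0 i else 0.

Definition quadratic_form (l : nat) (x : 'rV[F4]_(2 * l)%N) : F4 :=
  alpha * coord1 x 1 ^+ 2 + coord1 x 1 * coord1 x 2 + coord1 x 2 ^+ 2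
  + \sum_(2 <= i < l.+1) coord1 x (2 * i - 1)%N * coord1 x (2 * i)%N.

Definition D_ (l : nat) (beta : F4) : {set 'rV[F4]_(2 * l)%N} :=
  [set x | quadratic_form x == beta].

(* The product of two finZmodTypes is not a finZmodType in MathComp. *)
HB.instance Definition _ (U V : finZmodType) := GRing.Zmodule.on (U * V)%type.

Notation ambient l := (GR42 * 'rV[F4]_(2 * l - 2)%N)%type.

Definition F_map (l : nat) (x : 'rV[F4]_(2 * l)%N) : ambient l :=
  (red_inv (coord1 x 1) + 2%:R * red_inv (coord1 x 2),
   \row_(j < (2 * l - 2)%N) coord1 x (j + 3)%N).

Definition L_ (l : nat) (beta : F4) : {set ambient l} := @F_map l @: D_ l beta.

Definition four_sets (l : nat) : 4.-tuple {set ambient l} :=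
  [tuple L_ l 0 :\ 0; L_ l 1; L_ l alpha; L_ l (alpha ^+ 2)].

(* Main.v *)
Require Import Defs.
From mathcomp Require Import all_boot all_order all_algebra all_field.
From mathcomp Require Import ring zify.

Set Implicit Arguments.
Unset Strict Implicit.
Unset Printing Implicit Defensive.

Import GRing.Theory Num.Theory.
Local Open Scope ring_scope.

(** Write [n = 4 ^ l], let [G] be the ambient group, [Q] the quadratic form
    carried over to [G] by the bijection [F_map], and [chi] the character
    [(-1) ^ Tr] of the additive group of [F4], which has the values 1 and -1
    only.  For [c != 0] consider the function [W_c : x |-> chi (c * Q x)] on
    [G], and write [f * g] for convolution of integer functions on [G].

    The heart of the matter is the multiplication table
      [W_c * W_c = n ^ 2 delta_0]  and  [W_c * W_d = - n W_(c + d)] for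
    [c != d], together with [\sum_x W_c x = - n].  For an elliptic quadratic
    form on a vector space over [F4] this follows from Gauss sums.  Here the
    first two coordinates are not added as a plane over [F4] but as an element
    of [GR42]: in Teichmuller coordinates, addition has a carry
      [red_inv x + red_inv y = red_inv (x + y) + 2 red_inv ((x * y) ^ 2)]
    ([red_invD]), as for Witt vectors of length two.  All three relations are
    multiplicative over direct sums, hence it suffices to check them on the 16
    elements of each coordinate plane ([plane_gauss_sum], [plane_gauss_conv]):
    the hyperbolic planes satisfy them with 4 in place of [- n], the first
    plane with -4, even for the addition with carry.

    With [W_0 = - n delta_0], the functions [- W_c / n] multiply like the
    elements of the Klein four-group [(F4, +)].  Its four primitive idempotents
    are [P_b = 1/4 \sum_c chi (c * b) (- W_c / n)], and Fourier inversion on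
    [F4] turns the indicator function of [Q = b] into
      [E_b + (n / 4) delta_0],  where  [E_b = 1/4 - n P_b].
    Therefore [E_b * E_b'] is constant for [b != b'], and [E_b * E_b] is a
    constant minus [n E_b].  Removing the point 0 from the class [b = 0] leaves
    [E_0] unchanged and lowers the coefficient of [delta_0] to [n / 4 - 1]; with
    [r_b] the coefficient of [delta_0] in the class of [b], the constants become
    [r_b r_b' + (b == b') r_b] ([bent_neg_latin]).

    This law is what [neg_latin_colouring] records.  It determines every
    convolution of two classes, which gives the parameters of the partial
    difference sets and of the strongly regular graphs and the intersection
    numbers of the scheme.  Being bilinear, it also holds for unions of
    classes ([neg_latin_fuse]): every fusion is a scheme for the same
    reason. *)

(** * The ring GR(4,2) and its residue field *)

Lemma in_qpoly_self (A : comNzRingType) (h : {poly A}) :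
  (1 < size h)%N -> h \is monic -> in_qpoly h h = 0.
Proof.
move=> sh hm; apply: val_inj => /=.
by rewrite /mk_monic sh hm Pdiv.RingMonic.rmodpp.
Qed.

Definition GR42_poly : {poly 'Z_4} := 'X^2 + 'X + 1.

Lemma GR42_polyE : GR42_poly = Poly [:: 1; 1; 1].
Proof.
apply/polyP => i; rewrite /GR42_poly !coefD coefXn coefX coef1 coef_Poly.
by case: i => [|[|[|i]]] //=; rewrite ?nth_nil ?add0r ?addr0.
Qed.

Lemma size_GR42_poly : size GR42_poly = 3.
Proof. by rewrite GR42_polyE (@PolyK _ 0) // oner_neq0. Qed.

Lemma GR42_poly_monic : GR42_poly \is monic.
Proof. by apply/eqP; rewrite /lead_coef size_GR42_poly GR42_polyE coef_Poly. Qed.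

Lemma sqr_xi : xi ^+ 2 = - 1 - xi.
Proof.
have: in_qpoly GR42_poly GR42_poly = 0.
  by rewrite in_qpoly_self ?size_GR42_poly ?GR42_poly_monic.
rewrite {2}/GR42_poly !rmorphD rmorphXn rmorph1 /= => /eqP.
by rewrite -addrA addr_eq0 => /eqP ->; rewrite opprD addrC.
Qed.

Lemma polyn_xi : (xi : {poly 'Z_4}) = 'X.
Proof. by apply: qpolyXE; rewrite ?size_GR42_poly ?GR42_poly_monic. Qed.

Lemma GR42_char4 : 4%:R = 0 :> GR42.
Proof.
rewrite -[4%:R](rmorph_nat (in_qpoly GR42_poly)) -polyC_natr.
by rewrite pchar_Zp // polyC0 rmorph0.
Qed.

Lemma coef_xi i : (xi : {poly 'Z_4})`_i = (i == 1)%:R.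
Proof. by rewrite polyn_xi coefX. Qed.

Lemma coef_GR42_1 i : ((1 : GR42) : {poly 'Z_4})`_i = (i == 0)%:R.
Proof. by rewrite -[polyn _]/(1%:P) coefC; case: i. Qed.

Lemma F4_char2 : 2%:R = 0 :> F4.
Proof.
rewrite -[2%:R](rmorph_nat (in_qpoly F4_poly)) -polyC_natr.
by rewrite pchar_Zp // polyC0 rmorph0.
Qed.

(** [red] is defined on coefficients through natural numbers; this formula
    evaluates it on the few elements that matter without showing first that it
    is a ring morphism. *)
Lemma redE (r : GR42) :
  red r = (nat_of_ord (r : {poly 'Z_4})`_0)%:R
        + (nat_of_ord (r : {poly 'Z_4})`_1)%:R * in_qpoly F4_poly 'X.
Proof.
rewrite -!(rmorph_nat (in_qpoly F4_poly)) -rmorphM -rmorphD /red.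
congr in_qpoly; apply/polyP => i.
rewrite coef_map_id0 // -!polyC_natr coefD coefC coefCM coefX.
have sr : (size (r : {poly 'Z_4}) < 3)%N.
  apply: leq_trans (size_mk_monic r) _.
  by rewrite /mk_monic -/GR42_poly size_GR42_poly GR42_poly_monic size_GR42_poly.
case: i => [|[|i]] /=; rewrite ?mulr0 ?mulr1 ?addr0 ?add0r // nth_default //.
exact: leq_trans (sr : (_ <= 2)%N) _.
Qed.

Lemma alphaE : alpha = in_qpoly F4_poly 'X.
Proof. by rewrite /alpha redE !coef_xi /= add0r mul1r. Qed.

Lemma sqr_alpha : alpha ^+ 2 = alpha + 1.
Proof.
have: in_qpoly F4_poly F4_poly = 0 :> F4.
  by rewrite in_qpoly_self ?size_F4_poly ?F4_poly_mi.
rewrite {2}/F4_poly !rmorphD rmorphXn rmorph1 /= -alphaE => /eqP.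
by rewrite -addrA addr_eq0 => /eqP ->; rewrite oppr_pchar2 // inE /= F4_char2.
Qed.

Lemma red0 : red 0 = 0.
Proof. by rewrite redE polyseq0 /= add0r mul0r. Qed.

Lemma red1 : red 1 = 1.
Proof. by rewrite redE !coef_GR42_1 /= mul0r addr0. Qed.

Lemma red_sqr_xi : red (xi ^+ 2) = alpha ^+ 2.
Proof.
have three1 : 3%:R = 1 :> F4 by rewrite (natrD _ 1 2) F4_char2 addr0.
rewrite sqr_xi redE -alphaE sqr_alpha !coefB !coefN !coef_xi !coef_GR42_1.
by rewrite -[LHS]/(3%:R + 3%:R * alpha) three1 mul1r addrC.
Qed.

Lemma F4_addrr (x : F4) : x + x = 0.
Proof. by rewrite -mulr2n -mulr_natl F4_char2 mul0r. Qed.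

Lemma F4_opp (x : F4) : - x = x.
Proof. by apply/eqP; rewrite eq_sym -addr_eq0 F4_addrr. Qed.

Lemma card_F4 : #|F4| = 4.
Proof. by rewrite card_qfpoly size_F4_poly card_ord. Qed.

Lemma F4_expr4 (x : F4) : x ^+ 4 = x.
Proof. by rewrite -{2}(expf_card x) card_F4. Qed.

Lemma F4_natr_addb (b c : bool) : (b (+) c)%:R = b%:R + c%:R :> F4.
Proof. by case: b; case: c; rewrite ?addr0 ?add0r ?F4_addrr. Qed.

(** Coordinates in the basis [1, alpha].  Bit pairs with the operations [addk]
    and [mulk] below are a copy of [F4] that computes by reduction, so that
    identities over all of [F4] can be decided by evaluation. *)
Definition of_bits (k : bool * bool) : F4 := k.1%:R + k.2%:R * alpha.

Definition addk (k l : bool * bool) := (k.1 (+) l.1, k.2 (+) l.2).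

Definition mulk (k l : bool * bool) :=
  ((k.1 && l.1) (+) (k.2 && l.2),
   (k.1 && l.2) (+) (k.2 && l.1) (+) (k.2 && l.2)).

Lemma of_bitsD k l : of_bits (addk k l) = of_bits k + of_bits l.
Proof.
rewrite /of_bits addrACA -mulrDl /=.
by rewrite !F4_natr_addb.
Qed.

Lemma of_bitsM k l : of_bits (mulk k l) = of_bits k * of_bits l.
Proof.
rewrite /of_bits /= !F4_natr_addb -!mulnb !natrM.
ring: sqr_alpha.
Qed.

Lemma of_bits_bij : bijective of_bits.
Proof.
apply: inj_card_bij; last by rewrite card_F4 card_prod card_bool.
have alpha_neq0 : alpha != 0.
  apply/eqP => a0; have := sqr_alpha; rewrite a0 add0r expr0n /= => /esym/eqP.
  by rewrite oner_eq0.
have inj0 k : of_bits k = 0 -> k = (false, false).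
  case: k => [[] []] //=; rewrite /of_bits /= ?mul0r ?mul1r ?addr0 ?add0r => /eqP.
  - by rewrite addrC -sqr_alpha expf_eq0 (negPf alpha_neq0).
  - by rewrite oner_eq0.
  - by rewrite (negPf alpha_neq0).
move=> k l kl; have := inj0 (addk k l); rewrite of_bitsD kl F4_addrr => /(_ erefl).
by case: k l {kl} => [[] []] [[] []].
Qed.

(** The character [(-1) ^ Tr x]: the trace of [F4] over its prime field is
    [x + x ^+ 2], which vanishes exactly when [x ^+ 2 = x]. *)
Definition chi (x : F4) : int := if x ^+ 2 == x then 1 else -1.

Definition chik (k : bool * bool) : int := if k.2 then -1 else 1.

Lemma chi_of_bits k : chi (of_bits k) = chik k.
Proof.
rewrite /chi expr2 -of_bitsM (bij_eq of_bits_bij).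
by case: k => [[] []].
Qed.

Definition sumk (f : bool * bool -> int) : int :=
  f (false, false) + f (true, false) + f (false, true) + f (true, true).

Lemma eq_sumk f g : f =1 g -> sumk f = sumk g.
Proof. by move=> fg; rewrite /sumk !fg. Qed.

Lemma sum_bits (f : bool * bool -> int) : \sum_k f k = sumk f.
Proof.
rewrite (eq_bigr (fun k => f (k.1, k.2))) => [|[] //].
rewrite -(pair_bigA _ (fun a b => f (a, b))) /= !big_bool /sumk /=.
ring.
Qed.

Lemma sum_F4 (f : F4 -> int) : \sum_x f x = sumk (f \o of_bits).
Proof.
rewrite (reindex of_bits) /=; last exact/onW_bij/of_bits_bij.
exact: sum_bits.
Qed.

Lemma chiD x y : chi (x + y) = chi x * chi y.
Proof.
have [g _ gK] := of_bits_bij; rewrite -(gK x) -(gK y) -of_bitsD !chi_of_bits.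
by case: (g x) (g y) => [[] []] [[] []].
Qed.

Lemma of_bits_eq0 k : (of_bits k == 0) = (k == (false, false)).
Proof.
rewrite -(bij_eq of_bits_bij); congr (_ == _).
by rewrite /of_bits /= mul0r addr0.
Qed.

Lemma sum_F4_pair (f : F4 * F4 -> int) :
  \sum_p f p = sumk (fun k => sumk (fun l => f (of_bits k, of_bits l))).
Proof.
rewrite (eq_bigr (fun p => f (p.1, p.2))) => [|[] //].
rewrite -(pair_bigA _ (fun x y => f (x, y))) sum_F4.
by apply: eq_sumk => k /=; rewrite sum_F4.
Qed.

(** * Gauss sums of a coordinate plane *)

(** [plane_form true] is the form of the first two coordinates; it is
    anisotropic since [alpha] has trace 1.  [plane_form false] is the
    hyperbolic plane. *)
Definition plane_form (e : bool) (p : F4 * F4) : F4 :=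
  if e then alpha * p.1 ^+ 2 + p.1 * p.2 + p.2 ^+ 2 else p.1 * p.2.

(** Subtraction in Teichmuller coordinates: for [e = true] it is the one of
    [GR42], where [(p.1 * u.1) ^+ 2] is the square root of [p.1 * u.1], the
    carry of Witt vector addition, and the extra [u.1] comes from
    [- t = t + 2 t] in characteristic 4. *)
Definition plane_sub (e : bool) (p u : F4 * F4) : F4 * F4 :=
  (p.1 + u.1, p.2 + u.2 + (if e then u.1 + (p.1 * u.1) ^+ 2 else 0)).

Definition plane_sign (e : bool) : int := if e then -1 else 1.

Definition formk (e : bool) (k l : bool * bool) :=
  if e then addk (addk (mulk (false, true) (mulk k k)) (mulk k l)) (mulk l l)
  else mulk k l.

Definition subk (e : bool) (k l k' l' : bool * bool) :=
  addk (addk l l')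
    (if e then addk k' (mulk (mulk k k') (mulk k k')) else (false, false)).

Lemma of_bits_form e k l :
  plane_form e (of_bits k, of_bits l) = of_bits (formk e k l).
Proof.
rewrite /plane_form; case: e; last by rewrite of_bitsM.
have -> : alpha = of_bits (false, true) by rewrite /of_bits add0r mul1r.
by rewrite !of_bitsD !of_bitsM -!expr2.
Qed.

Lemma of_bits_sub e k l k' l' :
  plane_sub e (of_bits k, of_bits l) (of_bits k', of_bits l') =
  (of_bits (addk k k'), of_bits (subk e k l k' l')).
Proof.
rewrite /plane_sub !of_bitsD; case: e; first by rewrite !of_bitsD !of_bitsM -expr2.
by have /eqP-> : of_bits (false, false) == 0 by rewrite of_bits_eq0.
Qed.

(** Summing first over the second coordinate leaves a single value of the first
    one, by orthogonality; the sign records whether the plane is anisotropic.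
    The 16 terms are evaluated on bit pairs. *)
Lemma plane_gauss_sum e (c : F4) :
  c != 0 -> \sum_p chi (c * plane_form e p) = plane_sign e * 4%:R.
Proof.
have [g _ gK] := of_bits_bij; rewrite -(gK c).
move: (g c) => k {c gK}; rewrite of_bits_eq0 sum_F4_pair.
under eq_sumk => i do under eq_sumk => j do
  rewrite of_bits_form -of_bitsM chi_of_bits.
by case: e; case: k => [[] []] //; vm_compute.
Qed.

(** The multiplication table of the functions [chi (c * plane_form e _)] under
    convolution.  That it also holds for the subtraction with carry is the fact
    that lets [GR42] replace an elliptic plane; it is decided by evaluating the
    sum for all values of [c], [d] and [v]. *)
Lemma plane_gauss_conv e (c d : F4) v : c != 0 -> d != 0 ->
  \sum_u chi (c * plane_form e u) * chi (d * plane_form e (plane_sub e v u)) =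
  if c == d then 16%:R * (v == 0)%:R
  else plane_sign e * 4%:R * chi ((c + d) * plane_form e v).
Proof.
have [g _ gK] := of_bits_bij; case: v => x y.
have -> : ((x, y) == 0 :> F4 * F4) = (x == 0) && (y == 0) by [].
rewrite -(gK c) -(gK d) -(gK x) -(gK y) sum_F4_pair.
move: (g c) (g d) (g x) (g y) => {c d x y gK}c d x y.
rewrite (bij_eq of_bits_bij) !of_bits_eq0.
under eq_sumk => k do under eq_sumk => l do
  rewrite of_bits_sub !of_bits_form -!of_bitsM !chi_of_bits.
rewrite -of_bitsD of_bits_form -of_bitsM chi_of_bits.
move/negPf=> c0 /negPf d0; apply/eqP.
move: e c d x y c0 d0; case.
  by do 4!case=> [[] []] //; vm_compute.
by do 4!case=> [[] []] //; vm_compute.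
Qed.

(** * Gauss sums of the whole form *)

Lemma chi0 : chi 0 = 1. Proof. by rewrite /chi expr0n eqxx. Qed.

Lemma chi_sum (I : finType) (f : I -> F4) :
  chi (\sum_i f i) = \prod_i chi (f i).
Proof. by apply: big_morph; [exact: chiD | exact: chi0]. Qed.

Lemma plane_sub00 e : plane_sub e 0 0 = 0.
Proof. by case: e; rewrite /plane_sub /= !(add0r, mul0r) // expr0n. Qed.

Lemma plane_formN e p : plane_form e (plane_sub e 0 p) = plane_form e p.
Proof.
case: p => a b; rewrite /plane_sub /plane_form /= mul0r expr0n /= !add0r !addr0.
case: e; last by rewrite addr0.
transitivity (alpha * a ^+ 2 + a * b + b ^+ 2 + 2%:R * (a ^+ 2 + a * b)).
  by ring.
by rewrite F4_char2 mul0r addr0.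
Qed.

Section Global.
Variable l : nat.
Implicit Types p u v : {ffun 'I_l -> F4 * F4}.

(** Points are encoded by their [l] coordinate planes, since the form is an
    orthogonal sum and subtraction acts plane by plane; the plane of index 0 is
    the one with carry. *)
Definition pairs_form p : F4 := \sum_(i < l) plane_form (i == 0%N :> nat) (p i).

Definition pairs_sub v u : {ffun 'I_l -> F4 * F4} :=
  [ffun i : 'I_l => plane_sub (i == 0%N :> nat) (v i) (u i)].

Lemma pairs_sub00 : pairs_sub 0 0 = 0.
Proof. by apply/ffunP => i; rewrite !ffunE plane_sub00. Qed.

Lemma pairs_formN p : pairs_form (pairs_sub 0 p) = pairs_form p.
Proof. by apply: eq_bigr => i _; rewrite !ffunE plane_formN. Qed.

Lemma pairs_form0 : pairs_form 0 = 0.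
Proof.
by apply: big1 => i _; rewrite ffunE /plane_form /= mul0r expr0n mulr0 !addr0 if_same.
Qed.

Hypothesis l_gt0 : (0 < l)%N.

Lemma prod_plane_sign :
  \prod_(i < l) (plane_sign (i == 0%N :> nat) * 4%:R) = - (4 ^ l)%:R.
Proof.
case: l l_gt0 => // m _; rewrite big_ord_recl /= mulN1r.
rewrite (eq_bigr (fun=> 4%:R)) => [|i _]; last by rewrite mul1r.
by rewrite prodr_const card_ord mulNr -exprS natrX.
Qed.

(** [chi] turns the sum of forms into a product, so the sum over all points is
    the product over the planes of their Gauss sums. *)
Lemma pairs_gauss_sum c : c != 0 -> \sum_p chi (c * pairs_form p) = - (4 ^ l)%:R.
Proof.
move=> c0; rewrite -prod_plane_sign.
under [RHS]eq_bigr => i _ do rewrite -(plane_gauss_sum _ c0).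
rewrite bigA_distr_bigA; apply: eq_bigr => p _.
by rewrite mulr_sumr chi_sum.
Qed.

(** Again the product of the local tables; in the case [c == d] the product of
    the local deltas at 0 is the global one. *)
Lemma pairs_gauss_conv c d v : c != 0 -> d != 0 ->
  \sum_u chi (c * pairs_form u) * chi (d * pairs_form (pairs_sub v u)) =
  if c == d then (16 ^ l)%:R * (v == 0)%:R
  else - (4 ^ l)%:R * chi ((c + d) * pairs_form v).
Proof.
move=> c0 d0.
transitivity (\prod_(i < l) \sum_u chi (c * plane_form (i == 0%N :> nat) u) *
  chi (d * plane_form (i == 0%N :> nat) (plane_sub (i == 0%N :> nat) (v i) u))).
  rewrite bigA_distr_bigA; apply: eq_bigr => u _.
  rewrite big_split !mulr_sumr !chi_sum; congr (_ * _).
  by apply: eq_bigr => i _; rewrite ffunE.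
under eq_bigr => i _ do rewrite plane_gauss_conv //.
case: eqP => _.
  rewrite big_split prodr_const card_ord natrX; congr (_ * _).
  case: eqP => [->|v0].
    by rewrite big1 // => i _; rewrite ffunE eqxx.
  have /existsP[i /negPf vi] : [exists i, v i != 0].
    rewrite -negb_forall; apply/negP => /forallP h.
    by case: v0; apply/ffunP => i; rewrite ffunE; apply/eqP/h.
  by apply/eqP/prodf_eq0; exists i; rewrite ?vi.
by rewrite big_split prod_plane_sign mulr_sumr chi_sum.
Qed.

End Global.

(** * Teichmuller coordinates on the ambient group *)

Lemma F4P (x : F4) : [\/ x = 0, x = 1, x = alpha | x = alpha ^+ 2].
Proof.
have [g _ gK] := of_bits_bij; rewrite -(gK x) sqr_alpha /of_bits.
case: (g x) => [[] []] /=; rewrite ?mul0r ?mul1r ?addr0 ?add0r.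
- by constructor 4; rewrite addrC.
- by constructor 2.
- by constructor 3.
- by constructor 1.
Qed.

Lemma F4_basis : uniq [:: 0; 1; alpha; alpha ^+ 2].
Proof.
have -> : [:: 0; 1; alpha; alpha ^+ 2] =
  map of_bits [:: (false, false); (true, false); (false, true); (true, true)].
  by rewrite /= sqr_alpha /of_bits /= !mul0r !mul1r !addr0 !add0r addrC.
by rewrite (map_inj_uniq (bij_inj of_bits_bij)).
Qed.

Lemma uniq_map_inj_in (T1 T2 : eqType) (f : T1 -> T2) (s : seq T1) :
  uniq (map f s) -> {in s &, injective f}.
Proof.
elim: s => //= a s IHs /andP[fa us] x y.
rewrite !inE => /predU1P[->|xs] /predU1P[->|ys] // fxy; last exact: IHs.
  by rewrite fxy map_f in fa.
by rewrite -fxy map_f in fa.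
Qed.

Lemma red_inj_teichmuller : {in teichmuller &, injective red}.
Proof.
have teichE t : (t \in teichmuller) = (t \in [:: 0; 1; xi; xi ^+ 2]).
  by rewrite !inE -!orbA.
move=> s t; rewrite !teichE; apply: uniq_map_inj_in s t.
by rewrite [map _ _]/= red0 red1 red_sqr_xi F4_basis.
Qed.

Lemma red_inv_red t : t \in teichmuller -> red_inv (red t) = t.
Proof.
move=> tT; rewrite /red_inv; case: pickP => [s /andP[sT /eqP]|/(_ t)].
  exact: red_inj_teichmuller.
by rewrite tT eqxx.
Qed.

Lemma red_inv0 : red_inv 0 = 0.
Proof. by rewrite -red0 red_inv_red // !inE eqxx. Qed.

Lemma red_inv1 : red_inv 1 = 1.
Proof. by rewrite -red1 red_inv_red // !inE eqxx ?orbT. Qed.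

Lemma red_inv_alpha : red_inv alpha = xi.
Proof. by rewrite red_inv_red // !inE eqxx ?orbT. Qed.

Lemma red_inv_sqr_alpha : red_inv (alpha ^+ 2) = xi ^+ 2.
Proof. by rewrite -red_sqr_xi red_inv_red // !inE eqxx ?orbT. Qed.

Definition red_invE := (red_inv0, red_inv1, red_inv_alpha, red_inv_sqr_alpha).

Lemma red_invX2 x : red_inv (x ^+ 2) = red_inv x ^+ 2.
Proof.
have xi4 : xi ^+ 4 = xi by ring: sqr_xi.
have [] := F4P x => ->; rewrite ?expr0n ?expr1n ?red_invE ?expr0n ?expr1n //=.
by rewrite -!exprM F4_expr4 red_invE xi4.
Qed.

(** If [s] and [t] are the Teichmuller lifts of the square roots of [x] and [y],
    then [(s + t) ^ 2] is the Teichmuller lift of [x + y]; expanding, the carry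
    is [- 2 s t = 2 s t], where [s t] lifts the square root of [x * y].  In [F4]
    the square root is the square.  The proof goes through the 16 pairs. *)
Lemma red_invD x y :
  red_inv x + red_inv y = red_inv (x + y) + 2%:R * red_inv ((x * y) ^+ 2).
Proof.
have a3 : alpha * alpha ^+ 2 = 1.
  by rewrite sqr_alpha mulrDr mulr1 -expr2 sqr_alpha addrAC F4_addrr add0r.
have s4 : alpha + alpha ^+ 2 = 1 by rewrite sqr_alpha addrA F4_addrr add0r.
have s5 : 1 + alpha = alpha ^+ 2 by rewrite sqr_alpha addrC.
have s6 : 1 + alpha ^+ 2 = alpha by rewrite -s5 addrA F4_addrr add0r.
have a4 : alpha ^+ 2 * alpha ^+ 2 = alpha by rewrite -exprD F4_expr4.
have a2 : alpha * alpha = alpha ^+ 2 by [].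
rewrite red_invX2.
have [] := F4P x => ->; have [] := F4P y => ->;
  rewrite ?[1 * _]mul1r ?[_ * 1]mulr1 ?[0 * _]mul0r ?[_ * 0]mulr0 ?F4_addrr
    ?[0 + _]add0r ?[_ + 0]addr0 ?[alpha ^+ 2 * alpha]mulrC
    ?[alpha + 1]addrC ?[alpha ^+ 2 + 1]addrC ?[alpha ^+ 2 + alpha]addrC
    ?s4 ?s5 ?s6 ?a2 ?a3 ?a4 ?red_invE.
all: try by ring: sqr_xi.
(* The remaining cases hold modulo 4 only: add the multiple of 4 that
   balances the two sides. *)
all: have char4 t : 0 = 4%:R * t :> GR42 by rewrite GR42_char4 mul0r.
all: rewrite -[LHS]addr0; first
  [ by rewrite (char4 (- 1 - xi)); ring: sqr_xi
  | by rewrite (char4 xi); ring: sqr_xi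
  | by rewrite (char4 1); ring: sqr_xi ].
Qed.

Lemma red_inv_dbl_eq0 x : 2%:R * red_inv x = 0 -> x = 0.
Proof.
move=> h; have {h} c0 i : ((red_inv x : {poly 'Z_4})`_i) *+ 2 = 0.
  have := congr1 (fun k : GR42 => (k : {poly 'Z_4})`_i) h.
  by rewrite mulr_natl mulr2n coefD coef0 mulr2n.
have [] := F4P x => xE; rewrite xE red_invE in c0 *; rewrite ?sqr_xi // in c0.
- by have := c0 0; rewrite coef_GR42_1.
- by have := c0 1; rewrite coef_xi.
- by have := c0 1; rewrite coefB coefN coef_xi coef_GR42_1.
Qed.

Definition teich_pair (p : F4 * F4) : GR42 := red_inv p.1 + 2%:R * red_inv p.2.

(** The carry is a multiple of 2, so it disappears after doubling. *)
Lemma red_inv_dblD x y :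
  2%:R * red_inv (x + y) = 2%:R * red_inv x + 2%:R * red_inv y.
Proof.
by rewrite -mulrDr red_invD mulrDr mulrA -natrM GR42_char4 mul0r addr0.
Qed.

(** [red_invD] gives the carry of the first digits; the second digits add
    without carry by [red_inv_dblD]. *)
Lemma teich_pairB p u : teich_pair p - teich_pair u = teich_pair (plane_sub true p u).
Proof.
case: p u => [a b] [c d]; rewrite /teich_pair /=.
rewrite (red_inv_dblD (b + d)) (red_inv_dblD b) (red_inv_dblD c).
move: (red_invD a c).
move: (red_inv (a + c)) (red_inv ((a * c) ^+ 2)) (red_inv a) (red_inv b)
  (red_inv c) (red_inv d) => Tac W Ta Tb Tc Td E.
have {E}-> : Tac = Ta + Tc - 2%:R * W by rewrite E addrK.
apply/eqP; rewrite -subr_eq0; apply/eqP.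
transitivity (4%:R * - (Tc + Td)); first by ring.
by rewrite GR42_char4 mul0r.
Qed.

Section Ambient.
Variable l : nat.

Local Notation pairs := {ffun 'I_l -> F4 * F4}.

(** The coordinates of [p] in order, numbered from 0: the two coordinates of
    plane [i] are those of index [2 * i] and [2 * i + 1]. *)
Definition entry (p : pairs) (k : nat) : F4 :=
  if insub k./2 is Some i then (if odd k then (p i).2 else (p i).1) else 0.

Definition pairs_point (p : pairs) : ambient l :=
  (teich_pair (entry p 0, entry p 1),
   \row_(j < (2 * l - 2)%N) entry p (j + 2)).

Definition pairs_of_row (x : 'rV[F4]_(2 * l)%N) : pairs :=
  [ffun i : 'I_l => (coord1 x (2 * i + 1), coord1 x (2 * i + 2))].

Definition row_of_pairs (p : pairs) : 'rV[F4]_(2 * l)%N := \row_j entry p j.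

Lemma entry_ord (p : pairs) (i : 'I_l) :
  (entry p (2 * i) = (p i).1) * (entry p (2 * i + 1) = (p i).2).
Proof.
split; rewrite /entry.
  have -> : ((2 * i)./2 = i :> nat)%N by lia.
  by rewrite valK; have -> : odd (2 * i) = false by lia.
have -> : ((2 * i + 1)./2 = i :> nat)%N by lia.
by rewrite valK; have -> : odd (2 * i + 1) = true by lia.
Qed.

Lemma entryP k : (k < 2 * l)%N ->
  exists i : 'I_l, k = (2 * i)%N \/ k = (2 * i + 1)%N.
Proof.
move=> kl; have h : (k./2 < l)%N by lia.
exists (Ordinal h) => /=; lia.
Qed.

Lemma row_of_pairsK : cancel row_of_pairs pairs_of_row.
Proof.
move=> p; apply/ffunP => i; rewrite ffunE /coord1.
have h1 : ((2 * i + 1).-1 < 2 * l)%N by have := ltn_ord i; lia.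
have h2 : ((2 * i + 2).-1 < 2 * l)%N by have := ltn_ord i; lia.
rewrite !insubT !mxE /=.
have -> : ((2 * i + 1).-1 = 2 * i)%N by lia.
have -> : ((2 * i + 2).-1 = 2 * i + 1)%N by lia.
by rewrite !entry_ord; case: (p i).
Qed.

Lemma entry_pairs_of_row x k : (k < 2 * l)%N ->
  entry (pairs_of_row x) k = coord1 x k.+1.
Proof.
case/entryP => i [] ->; rewrite entry_ord ffunE /=; congr (coord1 x _); lia.
Qed.

Hypothesis l_gt1 : (1 < l)%N.

Lemma F_mapE x : F_map x = pairs_point (pairs_of_row x).
Proof.
rewrite /F_map /pairs_point /teich_pair /= !entry_pairs_of_row; try lia.
congr (_, _); apply/rowP => j; rewrite !mxE entry_pairs_of_row.
  by congr (coord1 x _); lia.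
have := ltn_ord j; lia.
Qed.

Lemma quadratic_formE x : quadratic_form x = pairs_form (pairs_of_row x).
Proof.
rewrite /quadratic_form /pairs_form.
have -> : \sum_(i < l) plane_form (i == 0%N :> nat) (pairs_of_row x i) =
  \sum_(0 <= i < l) plane_form (i == 0%N :> nat)
     (coord1 x (2 * i + 1), coord1 x (2 * i + 2)).
  by rewrite big_mkord; apply: eq_bigr => i _; rewrite ffunE.
rewrite [RHS]big_ltn; last exact: ltnW.
congr (_ + _); rewrite [LHS]big_add1 /=.
apply: eq_big_nat => i /andP[i0 _].
have -> : (i == 0%N) = false by lia.
by rewrite /plane_form /=; congr (coord1 x _ * coord1 x _); lia.
Qed.

(** In the first component this is the carry rule [teich_pairB]; the other
    coordinates are subtracted in [F4], where minus and plus agree. *)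
Lemma pairs_pointB v u :
  pairs_point v - pairs_point u = pairs_point (pairs_sub v u).
Proof.
have lt0l : (0 < l)%N by exact: ltnW.
pose i0 := Ordinal lt0l.
have e0 p : teich_pair (entry p 0, entry p 1) = teich_pair (p i0).
  by have := entry_ord p i0; rewrite /= => -[-> ->]; case: (p i0).
rewrite /pairs_point !e0; congr (_, _).
  by rewrite teich_pairB ffunE.
apply/rowP => j; rewrite !mxE.
have [i ij] : exists i : 'I_l, (j + 2 = 2 * i)%N \/ (j + 2 = 2 * i + 1)%N.
  by apply: entryP; have := ltn_ord j; lia.
have i_neq0 : (i == 0%N :> nat) = false by lia.
case: ij => ->; rewrite !entry_ord ffunE i_neq0 /=.
  by rewrite (F4_opp).
by rewrite addr0 F4_opp.
Qed.

Lemma card_GR42 : #|GR42| = 16.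
Proof.
by rewrite card_monic_qpoly ?size_GR42_poly ?GR42_poly_monic // card_ord.
Qed.

Lemma card_ambient : #|{: ambient l}| = (16 ^ l)%N.
Proof.
rewrite card_prod card_mx card_F4 card_GR42 mul1n.
have -> : (16 ^ l = 4 ^ (2 * l))%N by rewrite expnM.
by transitivity (4 ^ (2 + (2 * l - 2)))%N; [rewrite expnD | congr (4 ^ _)%N; lia].
Qed.

Lemma plane_sub_eq0 e p u : plane_sub e p u = 0 -> p = u.
Proof.
case: p u => [a b] [c d] pu0.
have /= /eqP := congr1 fst pu0; have /= /eqP := congr1 snd pu0 => {pu0}.
move=> h; rewrite -[c]F4_opp subr_eq0 F4_opp => /eqP ac; rewrite {}ac in h *.
move: h.
have -> : (if e then c + (c * c) ^+ 2 else 0) = 0.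
  by case: e => //; rewrite -expr2 -exprM F4_expr4 F4_addrr.
by rewrite addr0 -[d]F4_opp subr_eq0 F4_opp => /eqP->.
Qed.

(** By [pairs_pointB] only the fibre of 0 matters.  In the first component,
    multiplying by 2 kills the second Teichmuller digit, so the first digit is
    0, and then so is the second. *)
Lemma pairs_point_inj : injective pairs_point.
Proof.
move=> v u /eqP; rewrite -subr_eq0 pairs_pointB => /eqP vu0.
suff w0 i : pairs_sub v u i = 0.
  by apply/ffunP => i; apply: (@plane_sub_eq0 (i == 0%N :> nat)); rewrite -[RHS](w0 i) ffunE.
move: (pairs_sub v u) vu0 => w w0 {v u}.
have teich0 p : teich_pair p = 0 -> p = 0.
  case: p => a b; rewrite /teich_pair /= => h.
  have a0 : a = 0.
    apply: red_inv_dbl_eq0.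
    have := congr1 (fun k : GR42 => 2%:R * k) h.
    by rewrite /= mulrDr mulrA -natrM GR42_char4 mul0r addr0 mulr0.
  rewrite a0 red_inv0 add0r in h.
  by rewrite a0 (red_inv_dbl_eq0 h).
have e0 k : (k < 2 * l)%N -> entry w k = 0.
  have w01 : (entry w 0, entry w 1) = 0 by apply/teich0/(congr1 fst w0).
  case: k => [|[|k]] kl; [exact: (congr1 fst w01) | exact: (congr1 snd w01) |].
  have kl' : (k < 2 * l - 2)%N by lia.
  have := congr1 (fun z : ambient l => z.2 ord0 (Ordinal kl')) w0.
  by rewrite /= !mxE addn2.
have := ltn_ord i => il.
have := e0 (2 * i)%N; have := e0 (2 * i + 1)%N.
by rewrite !entry_ord; case: (w i) => a b /= -> ; [move=> -> //|]; lia.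
Qed.

Lemma pairs_point_bij : bijective pairs_point.
Proof.
apply: inj_card_bij; first exact: pairs_point_inj.
by rewrite card_ambient card_ffun card_prod card_F4 card_ord.
Qed.

End Ambient.

(** * Colourings of negative Latin square type *)

Section Colouring.
Variable G : finZmodType.

(** The partition of the nonzero elements of [G] is encoded by a colouring of
    [G], so that fusing classes amounts to composing with a map of colours. *)
Definition colour_class (I : eqType) (col : G -> I) (i : I) : {set G} :=
  [set g | (g != 0) && (col g == i)].

Lemma colour_class_level (I : eqType) (col : G -> I) i :
  col 0 != i -> colour_class col i = [set g | col g == i].
Proof.
move=> /negPf c0; apply/setP => g; rewrite !inE.
by case: (eqVneq g 0) => //= ->; rewrite c0.
Qed.

Lemma colour_class_level0 (I : eqType) (col : G -> I) i :
  colour_class col i = [set g | col g == i] :\ 0.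
Proof. by apply/setP => g; rewrite !inE. Qed.

(** In the group ring, the class [i] minus [r i] times the identity element.
    On nontrivial characters, a partial difference set of negative Latin square
    type takes only the values [r i] and [r i - n]; the shift turns them into 0
    and [- n]. *)
Definition shifted_class (I : finType) (col : G -> I) (r : I -> nat) (i : I)
    (g : G) : int :=
  (g \in colour_class col i)%:R - (r i)%:R * (g == 0)%:R.

(** The last condition is the convolution law of the shifted classes: up to
    constant functions, they are orthogonal and [- n] times idempotent.  The
    constants are those which make [r i * (n + 1)] the size of the class
    [i]. *)
Definition neg_latin_colouring (n : nat) (I : finType) (col : G -> I)
    (r : I -> nat) : Prop :=
  [/\ (forall i, 0 < r i)%N, forall g, col (- g) = col g &
      forall i j g,
        \sum_x shifted_class col r i x * shifted_class col r j (g - x) =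
        (r i * r j)%:R
        + (i == j)%:R * ((r i)%:R - n%:R * shifted_class col r i g)].

Section Fuse.
Variables (n : nat) (I J : finType) (col : G -> I) (r : I -> nat) (phi : I -> J).
Hypothesis phi_surj : forall j, exists i, phi i = j.

Definition fused_sizes (j : J) : nat := \sum_(i | phi i == j) r i.

(** Sizes and indicator functions both add up over the colours that are
    merged. *)
Lemma shifted_class_fuse j g :
  shifted_class (phi \o col) fused_sizes j g =
  \sum_(i | phi i == j) shifted_class col r i g.
Proof.
rewrite /shifted_class sumrB -mulr_suml natr_sum; congr (_ - _).
rewrite inE /=; case: eqP => [->|/eqP g0] /=.
  by rewrite big1 // => i _; rewrite inE eqxx.
rewrite (eq_bigr (fun i => (col g == i)%:R)) => [|i _]; last by rewrite inE g0.
rewrite big_mkcond (bigD1 (col g)) //= eqxx big1 => [|i /negPf ig].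
  by rewrite addr0; case: eqP.
by rewrite [col g == i]eq_sym ig if_same.
Qed.

(** The convolution law is bilinear, and the terms with [i == i'] survive only
    when both fused classes are the same, so the law is inherited by sums of
    shifted classes.  This is the reason why the scheme is amorphic. *)
Lemma neg_latin_fuse :
  neg_latin_colouring n col r ->
  neg_latin_colouring n (phi \o col) fused_sizes.
Proof.
case=> r_gt0 colN conv; split=> [j|g|j k g].
- have [i ij] := phi_surj j.
  by rewrite /fused_sizes (bigD1 i) ?ij //= addn_gt0 r_gt0.
- by rewrite /= colN.
transitivity (\sum_(i | phi i == j) \sum_(i' | phi i' == k)
   \sum_x shifted_class col r i x * shifted_class col r i' (g - x)).
  rewrite (eq_bigr (fun x => \sum_(i | phi i == j) \sum_(i' | phi i' == k)
     shifted_class col r i x * shifted_class col r i' (g - x))).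
    rewrite exchange_big; apply: eq_bigr => i _; exact: exchange_big.
  move=> x _; rewrite !shifted_class_fuse mulr_suml.
  by apply: eq_bigr => i _; rewrite mulr_sumr.
pose e i := (r i)%:R - n%:R * shifted_class col r i g.
transitivity (\sum_(i | phi i == j) \sum_(i' | phi i' == k)
   ((r i * r i')%:R + (i == i')%:R * e i)).
  by do 2!(apply: eq_bigr => ? _); rewrite conv.
have -> : (fused_sizes j)%:R - n%:R * shifted_class (phi \o col) fused_sizes j g = \sum_(i | phi i == j) e i.
  by rewrite shifted_class_fuse mulr_sumr sumrB -natr_sum.
under eq_bigr => i _ do rewrite big_split /=.
rewrite big_split /=; congr (_ + _).
  rewrite natrM /fused_sizes !natr_sum mulr_suml; apply: eq_bigr => i _.
  by rewrite mulr_sumr; apply: eq_bigr => i' _; rewrite natrM.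
rewrite mulr_sumr; apply: eq_bigr => i /eqP ij.
rewrite -mulr_suml; congr (_ * _).
rewrite -ij big_mkcond (bigD1 i) //= eqxx big1 => [|i' /negPf ii'].
  by rewrite addr0; case: ifP.
by rewrite [i == i']eq_sym ii' if_same.
Qed.

End Fuse.

Lemma card_int (P : pred G) : (#|[set x | P x]|)%:R = \sum_x (P x)%:R :> int.
Proof.
by rewrite -sum1_card natr_sum big_mkcond; apply: eq_bigr => x _; rewrite inE; case: (P x).
Qed.

Section Consequences.
Variables (n : nat) (I : finType) (col : G -> I) (r : I -> nat).
Hypothesis colP : neg_latin_colouring n col r.

Let r_gt0 i : (0 < r i)%N. Proof. by case: colP. Qed.

Lemma colour_classN i g : (- g \in colour_class col i) = (g \in colour_class col i).
Proof. by case: colP => _ colN _; rewrite !inE oppr_eq0 colN. Qed.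

Lemma colour_class0 i : (0 \in colour_class col i) = false.
Proof. by rewrite inE eqxx. Qed.

Lemma sum_delta (f : G -> int) a : \sum_x f x * (x == a)%:R = f a.
Proof.
rewrite (bigD1 a) //= eqxx mulr1 big1 ?addr0 // => x /negPf ->.
by rewrite mulr0.
Qed.

(** All the required counts reduce to this one: partial difference sets,
    common neighbours and intersection numbers are values of convolutions of
    indicator functions. *)
Definition pair_count i j g : nat :=
  #|[set w | (w \in colour_class col i) && (g - w \in colour_class col j)]|.

(** Substitute class = shifted class + [r] times delta at 0 in both factors
    and expand. *)
Lemma pair_countE i j g :
  (pair_count i j g)%:R =
  (r i * r j)%:R + (i == j)%:R * ((r i)%:R - n%:R * shifted_class col r i g)
  + (r i)%:R * shifted_class col r j g + (r j)%:R * shifted_class col r i g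
  + (r i * r j)%:R * (g == 0%R)%:R :> int.
Proof.
have [_ _ conv] := colP; rewrite -conv card_int.
have indE k x : (x \in colour_class col k)%:R =
  shifted_class col r k x + (r k)%:R * (x == 0)%:R.
  by rewrite /shifted_class subrK.
have Ej : \sum_x shifted_class col r j (g - x) * (x == 0)%:R = shifted_class col r j g.
  by rewrite sum_delta subr0.
have Ei : \sum_x shifted_class col r i x * (x == g)%:R = shifted_class col r i g.
  by rewrite sum_delta.
have E0 : \sum_x (x == g)%:R * (x == 0%R)%:R = (g == 0%R)%:R :> int.
  by rewrite sum_delta eq_sym.
rewrite -[in X in _ = X]Ei -[in X in _ = X]Ej -E0 !mulr_sumr -!big_split /=.
apply: eq_bigr => x _; rewrite -mulnb natrM !indE natrM.
rewrite subr_eq0 [g == x]eq_sym; ring.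
Qed.

(** The convolution of a symmetric class with itself takes its size as value
    at 0, so the size can be read off from [pair_countE]. *)
Lemma card_colour_class i : #|colour_class col i| = (r i * (n + 1))%N.
Proof.
have -> : #|colour_class col i| = pair_count i i 0.
  apply: eq_card => x; rewrite [RHS]inE sub0r colour_classN andbb //.
apply/eqP; rewrite -(eqr_nat int) pair_countE eqxx /shifted_class.
rewrite colour_class0 eqxx /= !natrM natrD; apply/eqP; ring.
Qed.

Lemma pair_count_neq0 i g : g != 0 ->
  (pair_count i i g)%:R = if g \in colour_class col i
     then - n%:Z + (r i)%:Z ^+ 2 + 3 * (r i)%:Z
     else ((r i) ^ 2 + r i)%:R :> int.
Proof.
move=> /negPf g0; rewrite pair_countE eqxx /shifted_class g0.
case: ifP => _; rewrite -?[Posz n]natz -?[Posz (r i)]natz ?natrD ?natrX ?natrM /=; ring.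
Qed.

Lemma colour_class_neq0 i : exists g, g \in colour_class col i.
Proof.
by apply/card_gt0P; rewrite card_colour_class muln_gt0 r_gt0 addn1.
Qed.

Lemma pair_count_eqcol i j g h : g != 0 -> h != 0 -> col g = col h ->
  pair_count i j g = pair_count i j h.
Proof.
move=> g0 h0 gh; apply/eqP; rewrite -(eqr_nat int) !pair_countE.
by rewrite /shifted_class !inE (negPf g0) (negPf h0) gh.
Qed.

Lemma colour_class_pds i : #|G| = (n ^ 2)%N ->
  negative_latin_square_pds (colour_class col i).
Proof.
move=> cardG; have [g0 g0i] := colour_class_neq0 i.
have g0_neq0 : g0 != 0 by move: g0i; rewrite inE => /andP[].
exists (n ^ 2)%N, (r i * (n + 1))%N, (pair_count i i g0), (r i ^ 2 + r i)%N; split; last first.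
  exists n, (r i); split=> //.
  by rewrite -[LHS]natz pair_count_neq0 // g0i.
split; rewrite ?card_colour_class // => g g_neq0.
transitivity (pair_count i i g).
  rewrite /pair_count -[in RHS](card_imset _ (f := fun w => (w, w - g))); last by move=> ? ? [].
  apply: eq_card => -[a b]; rewrite inE in_setX /=; apply/idP/imsetP.
    case/andP => /andP[ai bi] /andP[_ /eqP abg]; exists a.
      by apply/setIdP; split=> //; rewrite -colour_classN -abg !opprB addrC subrK.
    by rewrite -abg opprB addrC subrK.
  move=> [w /setIdP[wi gwi] [-> ->]].
  have wgE : w - (w - g) = g by rewrite opprB addrC subrK.
  rewrite wgE wi -[w - g \in _]colour_classN opprB gwi eqxx andbT /=.
  by rewrite -subr_eq0 wgE g_neq0.
apply/eqP; rewrite -(eqr_nat int) (pair_count_neq0 i g_neq0).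
case: ifP => // _; by rewrite (pair_count_neq0 i g0_neq0) g0i.
Qed.

Lemma card_translate (A : {set G}) x : #|[set y | x - y \in A]| = #|A|.
Proof.
rewrite -(card_imset _ (f := fun w => x - w)) => [|v w /addrI/oppr_inj //].
apply: eq_card => w; apply/imsetP/idP => [[y /[1!inE] yA ->] //|wA].
by exists (x - w); rewrite ?inE opprB addrC subrK.
Qed.

Lemma pair_count_translate i j x y :
  #|[set z | (x - z \in colour_class col i) && (z - y \in colour_class col j)]|
  = pair_count i j (x - y).
Proof.
rewrite -[RHS](card_translate _ x); apply: eq_card => z; rewrite [LHS]inE [RHS]inE [RHS]inE.
by rewrite opprB [X in _ = _ && (X \in _)]addrC addrA subrK.
Qed.

Lemma colour_class_srg i : #|G| = (n ^ 2)%N -> (r i + 1 < n)%N ->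
  strongly_regular (cayley (colour_class col i)).
Proof.
move=> cardG ltrn; have [g0 g0i] := colour_class_neq0 i.
have g0_neq0 : g0 != 0 by move: g0i; rewrite inE => /andP[].
have sym x y : (x - y \in colour_class col i) = (y - x \in colour_class col i).
  by rewrite -colour_classN opprB.
split=> [x y|x|]; [exact: sym | by rewrite /cayley subrr colour_class0 |].
exists (r i * (n + 1))%N, (pair_count i i g0), (r i ^ 2 + r i)%N; split=> [|x|x y].
- rewrite muln_gt0 r_gt0 addn1 cardG /=.
  have := r_gt0 i; nia.
- by rewrite card_translate card_colour_class.
rewrite -subr_eq0 => xy.
have -> : #|[set z | cayley (colour_class col i) x z
             && cayley (colour_class col i) y z]| = pair_count i i (x - y).
  rewrite -pair_count_translate; apply: eq_card => z; rewrite [LHS]inE [RHS]inE.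
  by rewrite /cayley [y - z \in _]sym.
apply/eqP; rewrite -(eqr_nat int) (pair_count_neq0 i xy) /cayley.
by case: ifP => // _; rewrite (pair_count_neq0 i g0_neq0) g0i.
Qed.

End Consequences.

(** The index of the relation of a translation scheme that contains the pairs
    with difference [g]; index 0 is the diagonal. *)
Definition colour_index d (col : G -> 'I_d) (g : G) : 'I_d.+1 :=
  if g == 0 then ord0 else lift ord0 (col g).

Lemma colour_index_eq0 d (col : G -> 'I_d) g :
  (colour_index col g == ord0) = (g == 0).
Proof.
by rewrite /colour_index; case: (g == 0) => //; exact/esym/negbTE/neq_lift.
Qed.

Lemma colour_index_eq_lift d (col : G -> 'I_d) g i :
  (colour_index col g == lift ord0 i) = (g \in colour_class col i).
Proof.
rewrite /colour_index inE; case: (g == 0) => /=; first exact/negbTE/neq_lift.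
by rewrite (inj_eq lift_inj).
Qed.

(** [pair_countE] involves [g] only through the class that contains it, so the
    number of [z] with given classes of [x - z] and [z - y] depends only on the
    class of [x - y]. *)
Lemma colouring_scheme (n d : nat) (col : G -> 'I_d) (r : 'I_d -> nat)
    (R : 'I_d.+1 -> {set G * G}) :
  neg_latin_colouring n col r ->
  (forall i x y, ((x, y) \in R i) = (colour_index col (x - y) == i)) ->
  assoc_scheme R.
Proof.
move=> colP RE.
have surj i : exists g, colour_index col g = i.
  rewrite /colour_index; case: (unliftP ord0 i) => [j|] ->; last by exists 0; rewrite eqxx.
  have [g] := colour_class_neq0 colP j; rewrite inE => /andP[/negPf g0 /eqP gj].
  by exists g; rewrite g0 gj.
have pairR g x : ((g, 0) \in R x) = (colour_index col g == x) by rewrite RE subr0.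
have colN g : colour_index col (- g) = colour_index col g.
  by rewrite /colour_index oppr_eq0; case: colP => _ -> _.
split.
- move=> i j Rij; have [g gi] := surj i.
  by apply/eqP; rewrite -gi -pairR -Rij pairR gi.
- apply/and3P; split.
  + rewrite eqEsubset subsetT /=; apply/subsetP => -[x y] _.
    apply/bigcupP; exists (R (colour_index col (x - y))); first exact: imset_f.
    by rewrite RE.
  + apply/trivIsetP => _ _ /imsetP[i _ ->] /imsetP[j _ ->] Rij.
    rewrite -setI_eq0; apply: contraR Rij => /set0Pn[[x y]].
    by rewrite inE !RE => /andP[/eqP-> /eqP->].
  + apply/negP => /imsetP[i _ R0]; have [g gi] := surj i.
    by have := pairR g i; rewrite gi eqxx -R0 inE.
- by apply/setP => -[x y]; rewrite RE inE /= colour_index_eq0 subr_eq0.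
- by move=> i x y _; rewrite !RE -opprB colN.
move=> i j k; have [h hk] := surj k.
pose N g := #|[set w | (colour_index col w == i) && (colour_index col (g - w) == j)]|.
exists (N h) => x y; rewrite RE => /eqP xyk.
transitivity (N (x - y)).
  rewrite -[RHS](card_translate _ x); apply: eq_card => z.
  rewrite [LHS]inE [RHS]inE [RHS]inE !RE.
  by rewrite opprB [X in _ = _ && (colour_index col X == _)]addrC addrA subrK.
rewrite -hk in xyk; move: (x - y) xyk => g gh.
have card1b (a : G) b : #|[set w | (w == a) && b]| = b.
  case: b; last by apply/eqP; rewrite cards_eq0; apply/eqP/setP => w; rewrite !inE andbF.
  by rewrite -[RHS](cards1 a); apply: eq_card => w; rewrite !inE andbT.
case: (unliftP ord0 i) => [e|] iE; last first.
  have N0 a : N a = (colour_index col a == j).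
    rewrite -(card1b 0); apply: eq_card => w; rewrite !inE iE colour_index_eq0.
    by case: eqP => // ->; rewrite subr0.
  by rewrite !N0 gh.
case: (unliftP ord0 j) => [f|] jE; last first.
  have N0 a : N a = (colour_index col a == lift ord0 e).
    rewrite -(card1b a); apply: eq_card => w; rewrite !inE iE jE colour_index_eq0 subr_eq0 andbC eq_sym.
    by case: eqP => // ->.
  by rewrite !N0 gh.
have NE a : N a = pair_count col e f a by apply: eq_card => w; rewrite inE iE jE !colour_index_eq_lift [RHS]inE.
rewrite !NE.
move: (colour_index_eq0 col g); rewrite gh colour_index_eq0; case: (eqVneq h 0) => [-> /esym/eqP-> //|h0 /esym/negbT g0].
apply: (pair_count_eqcol colP) => //.
by move: gh; rewrite /colour_index (negPf g0) (negPf h0) => /lift_inj.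
Qed.

(** A fusion is the scheme of the colouring composed with the map from colours
    to blocks of the partition. *)
Lemma colouring_amorphic (n d : nat) (col : G -> 'I_d) (r : 'I_d -> nat)
    (R : 'I_d.+1 -> {set G * G}) :
  neg_latin_colouring n col r ->
  (forall i x y, ((x, y) \in R i) = (colour_index col (x - y) == i)) ->
  amorphic_scheme R.
Proof.
move=> colP RE; split; first exact: colouring_scheme colP RE.
move=> P /and3P[/eqP coverP trivP P0].
have inP i : pblock P i \in P by rewrite pblock_mem // coverP inE.
pose phi i : 'I_#|P| := enum_rank_in (inP (col 0)) (pblock P i).
have phiE i b : (phi i == b) = (i \in enum_val b).
  apply/eqP/idP => [<-|ib].
    by rewrite enum_rankK_in // mem_pblock coverP inE.
  by apply: enum_val_inj; rewrite enum_rankK_in //; exact: def_pblock (enum_valP b) ib.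
have phi_surj b : exists i, phi i = b.
  have /set0Pn[i ib] : enum_val b != set0.
    by apply: contraNneq P0 => <-; exact: enum_valP.
  by exists i; apply/eqP; rewrite phiE.
apply: colouring_scheme (neg_latin_fuse phi_surj colP) _ => i x y.
rewrite /fusion /with_diagonal; case: (unliftP ord0 i) => [b|] -> /=; last first.
  by rewrite inE /= colour_index_eq0 subr_eq0.
rewrite colour_index_eq_lift inE /= phiE; apply/bigcupP/andP.
  by move=> [j jb]; rewrite RE colour_index_eq_lift inE => /andP[-> /eqP->].
by move=> [xy colb]; exists (col (x - y)); rewrite // RE colour_index_eq_lift inE xy eqxx.
Qed.

End Colouring.

(** * From Gauss sums to a colouring *)

Lemma chi_orthogonality (y : F4) : \sum_c chi (c * y) = 4%:R * (y == 0)%:R.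
Proof.
have [g _ gK] := of_bits_bij; rewrite -(gK y) sum_F4 of_bits_eq0.
rewrite (eq_sumk (g := fun k => chik (mulk k (g y)))).
  by case: (g y) => [[] []].
by move=> k /=; rewrite -of_bitsM chi_of_bits.
Qed.

(** The hypotheses on sums are the multiplication table of the functions
    [chi (c * Q _)], [c != 0], in the group ring of [G]: up to the normalization
    by [- n], where [n = 4 * m], they multiply like the nonzero elements of
    [F4] add. *)
Section Bent.
Variables (G : finZmodType) (Q : G -> F4) (m : nat).
Hypothesis m_gt1 : (1 < m)%N.
Hypothesis card_G : #|G| = ((4 * m) ^ 2)%N.
Hypothesis Q0 : Q 0 = 0.
Hypothesis QN : forall g, Q (- g) = Q g.
Hypothesis Q_sum : forall c, c != 0 -> \sum_x chi (c * Q x) = - (4 * m)%:R.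
Hypothesis Q_conv : forall c d g, c != 0 -> d != 0 ->
  \sum_x chi (c * Q x) * chi (d * Q (g - x)) =
  if c == d then ((4 * m) ^ 2)%:R * (g == 0)%:R
  else - (4 * m)%:R * chi ((c + d) * Q g).

Let n : int := (4 * m)%:R.

(** The choice [- n] times delta for [c = 0] completes the table: these four
    functions, divided by [- n], form a copy of the Klein four-group. *)
Definition klein_fun (c : F4) (x : G) : int :=
  if c == 0 then - n * (x == 0)%:R else chi (c * Q x).

Lemma klein_fun_sum c : \sum_x klein_fun c x = - n.
Proof.
rewrite /klein_fun; case: eqP => [_|/eqP]; last exact: Q_sum.
exact: (sum_delta (fun=> - n)).
Qed.

Lemma klein_fun_conv c d g :
  \sum_x klein_fun c x * klein_fun d (g - x) = - n * klein_fun (c + d) g.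
Proof.
have [->|c0] := eqVneq c 0.
  rewrite add0r -[in RHS](subr0 g) -(sum_delta (fun x => - n * klein_fun d (g - x)) 0).
  by apply: eq_bigr => x _; rewrite {1}/klein_fun eqxx mulrAC.
have [->|d0] := eqVneq d 0.
  rewrite addr0 -(sum_delta (fun x => - n * klein_fun c x) g).
  apply: eq_bigr => x _; rewrite {2}/klein_fun eqxx subr_eq0 [g == x]eq_sym.
  by rewrite mulrA [_ * - n]mulrC.
rewrite /klein_fun (negPf c0) (negPf d0) Q_conv //.
rewrite -[in RHS](F4_opp d) subr_eq0; case: eqP => [_|_].
  by rewrite natrX mulrA mulrNN.
by rewrite F4_opp.
Qed.

(** The four primitive idempotents of the group algebra of the Klein
    four-group, up to the factor [- 4 n]. *)
Definition klein_idem (b : F4) (x : G) : int := \sum_c chi (c * b) * klein_fun c x.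

Lemma klein_idem_sum b : \sum_x klein_idem b x = - (4%:R * n) * (b == 0)%:R.
Proof.
rewrite exchange_big /=.
under eq_bigr => c _ do rewrite -mulr_sumr klein_fun_sum.
by rewrite -mulr_suml chi_orthogonality; ring.
Qed.

(** Orthogonality of characters of the Klein four-group, after the change of
    variable [e = c + d]. *)
Lemma klein_idem_conv b b' g :
  \sum_x klein_idem b x * klein_idem b' (g - x) =
  - (4%:R * n) * (b == b')%:R * klein_idem b g.
Proof.
transitivity (\sum_c \sum_d chi (c * b) * chi (d * b') * (- n * klein_fun (c + d) g)).
  under eq_bigr => x _ do rewrite mulr_suml; rewrite exchange_big /=.
  apply: eq_bigr => c _.
  under eq_bigr => x _ do rewrite mulr_sumr; rewrite exchange_big /=.
  apply: eq_bigr => d _; rewrite -klein_fun_conv mulr_sumr.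
  by apply: eq_bigr => x _; rewrite mulrACA.
transitivity (\sum_e \sum_d chi (d * (b + b')) * (chi (e * b) * (- n * klein_fun e g))).
  rewrite [RHS]exchange_big [LHS]exchange_big; apply: eq_bigr => d _ /=.
  rewrite (reindex_inj (addrI d)); apply: eq_bigr => c _ /=.
  rewrite [d + c + d]addrAC F4_addrr add0r mulrA; congr (_ * _).
  by rewrite -!chiD; congr chi; ring.
under eq_bigr => e _ do rewrite -mulr_suml chi_orthogonality.
rewrite -{1}(F4_opp b') subr_eq0 mulr_sumr; apply: eq_bigr => e _; ring.
Qed.

(** The class of 0 has one element less, namely 0, than the zero set of [Q];
    this lowers the coefficient of the identity by one. *)
Definition bent_size (b : F4) : nat := (m - (b == 0%R))%N.

Lemma bent_size_int b : (bent_size b)%:R = m%:R - (b == 0%R)%:R :> int.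
Proof. by rewrite /bent_size natrB //; case: (b == 0) => //; exact: ltnW. Qed.

(** Fourier inversion on [F4]: [4 (Q g == b)] is the sum over [c] of
    [chi (c * (Q g + b))].  Its term [c = 0] is 1 instead of the value
    [- n delta] of [klein_fun], and this accounts for the shift by [m = n / 4]
    at 0. *)
Lemma shifted_classE b g :
  4%:R * shifted_class Q bent_size b g = 1 + klein_idem b g.
Proof.
have -> : klein_idem b g = 4%:R * (Q g == b)%:R - 1 - n * (g == 0)%:R.
  have -> : 4%:R * (Q g == b)%:R = \sum_c chi (c * (Q g + b)) :> int.
    by rewrite chi_orthogonality -[in RHS](F4_opp b) subr_eq0.
  rewrite /klein_idem (bigD1 0) //= [in RHS](bigD1 0) //= /klein_fun eqxx !mul0r.
  rewrite chi0 mul1r [1 + _]addrC addrK addrC mulNr; congr (_ + _).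
  apply: eq_bigr => c /negPf->; rewrite -chiD; congr chi; ring.
rewrite /shifted_class inE bent_size_int /n natrM; case: (eqVneq g 0) => [->|_] /=.
  by rewrite Q0 [0 == b]eq_sym; ring.
ring.
Qed.

(** Expand the product of two factors [1 + klein_idem]; the factor 16 clears
    the denominators of [shifted_classE]. *)
Lemma bent_neg_latin : neg_latin_colouring (4 * m) Q bent_size.
Proof.
split=> [b|//|b b' g]; first by rewrite subn_gt0; case: (b == 0) => //; exact: ltnW.
have neq16 : (16%:R : int) != 0 by [].
apply: (mulfI neq16).
have -> : 16%:R * (\sum_x shifted_class Q bent_size b x *
    shifted_class Q bent_size b' (g - x)) =
  \sum_x (1 + klein_idem b x) * (1 + klein_idem b' (g - x)).
  rewrite mulr_sumr; apply: eq_bigr => x _; rewrite -!shifted_classE; ring.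
transitivity (n ^+ 2 + \sum_x klein_idem b x + \sum_x klein_idem b' (g - x)
  + \sum_x klein_idem b x * klein_idem b' (g - x)).
  have -> : n ^+ 2 = \sum_(x : G) 1.
    by rewrite sumr_const card_G natrX.
  by rewrite -!big_split; apply: eq_bigr => x _ /=; ring.
have -> : \sum_x klein_idem b' (g - x) = \sum_x klein_idem b' x.
  rewrite [RHS](reindex_inj (inv_inj (subKr g))) //.
rewrite !klein_idem_sum klein_idem_conv.
have -> : klein_idem b g = 4%:R * shifted_class Q bent_size b g - 1.
  by rewrite shifted_classE addrAC subrr add0r.
rewrite natrM !bent_size_int /n natrM.
have [->|bb'] := eqVneq b b'; first by case: (b' == 0) => /=; ring.
have [b0|_] := eqVneq b 0; last by case: (b' == 0) => /=; ring.
by rewrite [b' == 0]eq_sym -b0 (negPf bb') /=; ring.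
Qed.

End Bent.

(** * The four sets *)

(** The quadratic form in terms of the group: transport it along
    [pairs_point], for which subtraction is computed plane by plane. *)
Lemma ambient_colouring (l : nat) (l_gt1 : (1 < l)%N) :
  exists Q : ambient l -> F4,
    [/\ Q 0 = 0, forall b, L_ l b = [set g | Q g == b] &
        neg_latin_colouring (4 ^ l) Q (bent_size (4 ^ l.-1))].
Proof.
have l_gt0 : (0 < l)%N by exact: ltnW.
have [inv pointK invK] := pairs_point_bij l_gt1.
pose Q (g : ambient l) := pairs_form (inv g).
have nE : (4 ^ l = 4 * 4 ^ l.-1)%N by rewrite -expnS prednK.
have point0 : pairs_point (0 : {ffun 'I_l -> F4 * F4}) = 0.
  by rewrite -pairs_sub00 -pairs_pointB // subrr.
have inv0 : inv 0 = 0 by rewrite -point0 pointK.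
have Q0 : Q 0 = 0 by rewrite /Q inv0 pairs_form0.
exists Q; split=> // [b|].
  apply/setP => g; rewrite inE; apply/imsetP/eqP => [[x]|gb].
    by rewrite inE F_mapE // quadratic_formE // /Q => /eqP <- ->; rewrite pointK.
  exists (row_of_pairs (inv g)); last by rewrite F_mapE // row_of_pairsK invK.
  by rewrite inE quadratic_formE // row_of_pairsK -gb.
have point_bij : {on [pred _ | true], bijective (@pairs_point l)}.
  by exists inv => ? _.
rewrite nE; apply: bent_neg_latin => //.
- by rewrite -[1%N]/(4 ^ 0)%N ltn_exp2l //; lia.
- by rewrite -nE card_ambient // (expnAC 4 l 2).
- move=> g; rewrite -(sub0r g) -point0 -(invK g) pairs_pointB //.
  by rewrite /Q !pointK pairs_formN.
- move=> c c0; rewrite -nE -(pairs_gauss_sum l_gt0 c0).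
  rewrite (reindex _ point_bij) /Q.
  by apply: eq_bigr => p _; rewrite pointK.
move=> c d g c0 d0; rewrite -nE (reindex _ point_bij) -{1}(invK g).
under eq_bigr => p _ do rewrite pairs_pointB // /Q !pointK.
by rewrite pairs_gauss_conv // (expnAC 4 l 2) -[in g == 0](can_eq invK) inv0.
Qed.

Theorem theorem3p6 (l : nat) (hl : (2 <= l)%N) :
  (forall i : 'I_4, negative_latin_square_pds (tnth (four_sets l) i)) /\
  (forall i : 'I_4, strongly_regular (cayley (tnth (four_sets l) i))) /\
  amorphic_scheme
    (graph_relations (fun i : 'I_4 => cayley (tnth (four_sets l) i))).
Proof.
have [Q [Q0 LE Qcol]] := ambient_colouring hl.
have cardG : #|{: ambient l}| = ((4 ^ l) ^ 2)%N.
  by rewrite card_ambient // (expnAC 4 l 2).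
have r_small b : (bent_size (4 ^ l.-1) b + 1 < 4 ^ l)%N.
  have : (0 < 4 ^ l.-1)%N by rewrite expn_gt0.
  have -> : (4 ^ l = 4 * 4 ^ l.-1)%N by rewrite -expnS prednK // ltnW.
  by rewrite /bent_size; lia.
pose bs : 4.-tuple F4 := [tuple 0; 1; alpha; alpha ^+ 2].
have bs_inj : injective (tnth bs) by exact/tuple_uniqP/F4_basis.
have setE i : tnth (four_sets l) i = colour_class Q (tnth bs i).
  have [->|i0] := eqVneq i ord0.
    rewrite (tnth_nth set0) (tnth_nth 0) [RHS]colour_class_level0 -LE.
    by [].
  have b0 : tnth bs i != 0 by rewrite -(inj_eq bs_inj) in i0.
  have -> : tnth (four_sets l) i = L_ l (tnth bs i).
    rewrite (tnth_nth set0) (tnth_nth 0).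
    by case: i i0 {b0} => [[|[|[|[|//]]]] lti].
  by rewrite LE colour_class_level // Q0 eq_sym.
split=> [i|]; first by rewrite setE; apply: colour_class_pds Qcol _ _.
split=> [i|]; first by rewrite setE; apply: colour_class_srg Qcol _ _ _.
(* Relabel the colours by 'I_4, in the order of the four sets; this is a
   fusion in which no two classes are merged. *)
have [ix ixK bsK] : bijective (tnth bs).
  apply: inj_card_bij; last by rewrite card_F4 card_ord.
  exact: bs_inj.
have surj_ix j : exists b, ix b = j by exists (tnth bs j); rewrite ixK.
apply: colouring_amorphic (neg_latin_fuse surj_ix Qcol) _ => i x y.
rewrite /graph_relations /with_diagonal; case: (unliftP ord0 i) => [j|] -> /=.
  rewrite inE /= /cayley setE colour_index_eq_lift !inE /=.
  by rewrite -(can_eq bsK) ixK.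
by rewrite inE /= colour_index_eq0 subr_eq0.
Qed.
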